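(* Let $C$ be a real $m\times r$ matrix of full column rank $r$ (its $r$ columns are linearly independent) and let $R$ be a real $r\times n$ matrix of full row rank $r$ (its $r$ rows are linearly independent). Let $A = CR$, an $m\times n$ matrix. Then the pseudoinverse of $A$ is the product of the pseudoinverses in reverse order: $$A^+ = (CR)^+ = R^+C^+.$$
   Context: For a real $m\times n$ matrix $M$, $M^+$ denotes its Moore–Penrose pseudoinverse: the unique real $n\times m$ matrix satisfying the four Penrose identities $MM^+M=M$, $M^+MM^+=M^+$, $(M^+M)^{\mathrm T}=M^+M$, $(MM^+)^{\mathrm T}=MM^+$. *)

(* Defs.v *)
From mathcomp Require Import all_boot all_order all_algebra.
From mathcomp Require Import boolp classical_sets reals.

Set Implicit Arguments.
Unset Strict Implicit.
Unset Printing Implicit Defensive.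

Import Order.TTheory GRing.Theory Num.Theory.
Local Open Scope ring_scope.

Definition penrose (K : realType) (m n : nat) (M : 'M[K]_(m, n))
    (X : 'M[K]_(n, m)) : Prop :=
  [/\ M *m X *m M = M,
      X *m M *m X = X,
      (X *m M)^T = X *m M &
      (M *m X)^T = M *m X].

(* Not mathcomp's pinvmx, which is built by Gaussian elimination and need not
   satisfy the two symmetry identities. The default value 0 is never used, by
   penrose_exists. *)
Definition mpinv (K : realType) (m n : nat) (M : 'M[K]_(m, n)) : 'M[K]_(n, m) :=
  xget 0 [set X | penrose M X]%classic.

Lemma penrose_unique (K : realType) (m n : nat) (M : 'M[K]_(m, n)) X Y :
  penrose M X -> penrose M Y -> X = Y.
Proof.
case=> X1 X2 X3 X4 [Y1 Y2 Y3 Y4].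
have eMX : M *m X = M *m Y.
  by rewrite -X4 -{1}Y1 -mulmxA trmx_mul X4 Y4 mulmxA X1.
have eXM : X *m M = Y *m M.
  by rewrite -X3 -{1}Y1 -[M *m Y *m M]mulmxA mulmxA trmx_mul X3 Y3 -mulmxA
             [M *m (X *m M)]mulmxA X1.
by rewrite -X2 -mulmxA eMX mulmxA eXM Y2.
Qed.

Lemma gram_unitmx (K : realType) (m n : nat) (B : 'M[K]_(m, n)) :
  row_free B -> B *m B^T \in unitmx.
Proof.
move=> fB; rewrite -row_free_unit; apply: inj_row_free => v vBB.
apply/eqP; rewrite -(mulmx_free_eq0 v fB); apply/eqP/rowP => j.
have /eqP : ((v *m B) *m (v *m B)^T) 0 0 = 0.
  by rewrite trmx_mul !mulmxA -[v *m B *m _]mulmxA vBB mul0mx mxE.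
rewrite mxE psumr_eq0 => [/allP/(_ j (mem_index_enum j))|i _].
  by rewrite !mxE mulf_eq0 orbb => /eqP.
by rewrite !mxE -expr2 sqr_ge0.
Qed.

Lemma penrose_exists (K : realType) (m n : nat) (M : 'M[K]_(m, n)) :
  exists X, penrose M X.
Proof.
have [r [C [R [fC fR ->]]]] : exists r (C : 'M[K]_(m, r)) (R : 'M[K]_(r, n)),
    [/\ row_full C, row_free R & M = C *m R].
  exists (\rank M), (col_base M), (row_base M).
  by rewrite col_base_full row_base_free mulmx_base.
have uR : R *m R^T \in unitmx by exact: gram_unitmx.
have uC : C^T *m C \in unitmx.
  by rewrite -{2}[C]trmxK; apply: gram_unitmx; rewrite /row_free mxrank_tr.
pose R' := R^T *m invmx (R *m R^T); pose C' := invmx (C^T *m C) *m C^T.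
have RR' : R *m R' = 1%:M by rewrite mulmxA mulmxV.
have CC' : C' *m C = 1%:M by rewrite -mulmxA mulVmx.
have MX : C *m R *m (R' *m C') = C *m C'.
  by rewrite mulmxA -[C *m R *m R']mulmxA RR' mulmx1.
have XM : (R' *m C') *m (C *m R) = R' *m R.
  by rewrite mulmxA -[R' *m C' *m C]mulmxA CC' mulmx1.
exists (R' *m C'); split; rewrite ?MX ?XM.
- by rewrite mulmxA -[C *m C' *m C]mulmxA CC' mulmx1.
- by rewrite mulmxA -[R' *m R *m R']mulmxA RR' mulmx1.
- by rewrite /R' !trmx_mul trmxK trmx_inv trmx_mul trmxK mulmxA.
- by rewrite /C' !trmx_mul trmxK trmx_inv trmx_mul trmxK mulmxA.
Qed.

Lemma mpinvP (K : realType) (m n : nat) (M : 'M[K]_(m, n)) :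
  penrose M (mpinv M).
Proof. exact: xgetPex (penrose_exists M). Qed.

(* Main.v *)
Require Import Defs.
From mathcomp Require Import all_boot all_order all_algebra.
From mathcomp Require Import reals.

Local Open Scope ring_scope.

(** Full rank turns the pseudoinverses into one-sided inverses: cancelling [C]
    on the left of [C C^+ C = C] gives [C^+ C = 1], and cancelling [R] on the
    right of [R R^+ R = R] gives [R R^+ = 1].  With [X = R^+ C^+] the inner
    factors therefore collapse: [(C R) X = C C^+] and [X (C R) = R^+ R], which
    are symmetric because [C^+] and [R^+] are pseudoinverses.  The other two
    Penrose identities for [C R] follow from the same collapse, and
    [penrose_unique] identifies [X] with [(C R)^+]. *)

Lemma mpinv_mul_full (K : realType) (m r : nat) (C : 'M[K]_(m, r)) :
  row_full C -> mpinv C *m C = 1%:M.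
Proof.
move=> fC; have [CXC _ _ _] := mpinvP C.
by apply: (row_full_inj fC); rewrite mulmxA CXC mulmx1.
Qed.

Lemma mul_mpinv_free (K : realType) (r n : nat) (R : 'M[K]_(r, n)) :
  row_free R -> R *m mpinv R = 1%:M.
Proof.
move=> fR; have [RXR _ _ _] := mpinvP R.
by apply: (row_free_inj fR); rewrite RXR mul1mx.
Qed.

Theorem theorem1 (K : realType) (m n r : nat)
    (C : 'M[K]_(m, r)) (R : 'M[K]_(r, n))
    (hC : \rank C = r) (hR : \rank R = r) :
  mpinv (C *m R) = mpinv R *m mpinv C.
Proof.
have CC : mpinv C *m C = 1%:M by apply: mpinv_mul_full; apply/eqP.
have RR : R *m mpinv R = 1%:M by apply: mul_mpinv_free; apply/eqP.
have [C1 C2 _ C4] := mpinvP C; have [R1 R2 R3 _] := mpinvP R.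
have AX : C *m R *m (mpinv R *m mpinv C) = C *m mpinv C.
  by rewrite mulmxA -(mulmxA C) RR mulmx1.
have XA : mpinv R *m mpinv C *m (C *m R) = mpinv R *m R.
  by rewrite mulmxA -(mulmxA (mpinv R)) CC mulmx1.
apply: (penrose_unique (mpinvP (C *m R))); split; rewrite ?AX ?XA //.
- by rewrite mulmxA C1.
- by rewrite mulmxA R2.
Qed.
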